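(* For all integers $m\geq n\geq 1$, let $K_{n,m}$ denote the complete bipartite graph on $n+m$ vertices (with parts of sizes $n$ and $m$). Then $$\mathrm{mdeg}(K_{n,m})=\begin{cases}2&\text{if } m=n=1\\3&\text{if } m\geq 2\text{ and } n=1\\4&\text{if } m,n\geq 2.\end{cases}$$
   Context: Graphs are simple and undirected. A connected graph $M$ with graph metric $d$ is median if for all vertices $x_1,x_2,x_3$ there is a unique vertex $m$ with $d(x_i,x_j)=d(x_i,m)+d(m,x_j)$ for all $i\neq j$. Two edges $\{a,b\},\{x,y\}$ of a connected graph are in $\Theta$-relation if $d(a,x)+d(b,y)\neq d(a,y)+d(b,x)$. In a median graph $\Theta$ is an equivalence relation on edges, the reflexive-transitive closure of ''being opposite edges of a square'' (square = induced 4-cycle). Two distinct $\Theta$-classes cross if they both contain an edge of a common square. The crossing graph $\mathrm{Cross}(M)$ has as vertices the $\Theta$-classes of $M$, two $\Theta$-classes being adjacent when they cross. The degree of a graph is the supremum of the degrees of its vertices. The median degree $\mathrm{mdeg}(X)$ of a graph $X$ is the smallest degree of a median graph $M$ with $\mathrm{Cross}(M)\simeq X$ (it is known that such an $M$ always exists). *)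

(* Defs.v *)
From mathcomp Require Import all_boot.
From mathcomp Require Import all_classical.

Set Implicit Arguments.
Unset Strict Implicit.
Unset Printing Implicit Defensive.

Local Open Scope classical_set_scope.
Local Open Scope card_scope.

Record sgraph := SGraph {
  vertex :> Type;
  adj : rel vertex;
  adj_sym : symmetric adj;
  adj_irrefl : irreflexive adj }.

Definition isomorphic (G H : sgraph) : Prop :=
  exists2 f : G -> H, bijective f & forall x y, adj (f x) (f y) = adj x y.

Section Metric.
Variable G : sgraph.

Definition walk_of_size (x y : G) (k : nat) : Prop :=
  exists p : seq G, [/\ path (@adj G) x p, last x p = y & size p = k].

Definition connected : Prop := forall x y : G, exists k, walk_of_size x y k.

(* The default value 0 is only used when x and y are not joined by a walk. *)
Definition dist (x y : G) : nat :=
  xget 0 [set k | walk_of_size x y k /\ forall l, walk_of_size x y l -> k <= l].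

Definition median : Prop :=
  connected /\
  forall x1 x2 x3 : G, exists! m : G,
    [/\ dist x1 x2 = dist x1 m + dist m x2,
        dist x2 x3 = dist x2 m + dist m x3 &
        dist x1 x3 = dist x1 m + dist m x3].

(* Supremum of the vertex degrees in N with infinity; only finite values are
   named, so has_degree k holds for no k when the degrees are unbounded or some
   vertex has infinitely many neighbours. *)
Definition degree_le (k : nat) : Prop :=
  forall x : G, [set y : G | adj x y] #<= `I_k.

Definition has_degree (k : nat) : Prop :=
  degree_le k /\ forall l, degree_le l -> k <= l.

End Metric.

Section Crossing.
Variable M : sgraph.

(* Edges are unordered pairs, i.e. two-element sets of vertices. *)
Definition edges : set (set M) :=
  [set e | exists a b : M, adj a b /\ e = [set a; b]].

Definition theta (e f : set M) : Prop :=
  exists a b x y : M,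
    [/\ adj a b, adj x y, e = [set a; b], f = [set x; y] &
        dist a x + dist b y <> dist a y + dist b x].

(* These are the equivalence classes only when theta is an equivalence relation
   on edges, as it is in a median graph. *)
Definition theta_class (C : set (set M)) : Prop :=
  exists2 e, edges e & C = [set f | theta e f].

Definition square (a b c d : M) : Prop :=
  [/\ [&& adj a b, adj b c, adj c d & adj d a],
      a <> c /\ b <> d & ~~ adj a c && ~~ adj b d].

Definition square_edges (a b c d : M) : set (set M) :=
  [set e | [\/ e = [set a; b], e = [set b; c], e = [set c; d] | e = [set d; a]]].

Definition crosses (C D : set (set M)) : Prop :=
  C <> D /\
  exists a b c d : M,
    [/\ square a b c d, C `&` square_edges a b c d !=set0 &
        D `&` square_edges a b c d !=set0].

Definition Cross_adj : rel {C : set (set M) | theta_class C} :=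
  fun C D => `[< crosses (proj1_sig C) (proj1_sig D) >].

Lemma Cross_adj_sym : symmetric Cross_adj.
Proof.
move=> C D; apply/asboolP/asboolP => -[neq [a [b [c [d [sq hC hD]]]]]];
  by split; [move=> eqCD; apply: neq | exists a, b, c, d].
Qed.

Lemma Cross_adj_irrefl : irreflexive Cross_adj.
Proof. by move=> C; apply/asboolP => -[]. Qed.

Definition Cross : sgraph := SGraph Cross_adj_sym Cross_adj_irrefl.

End Crossing.

(* A median graph of infinite degree never beats a finite degree d, so the
   minimality clause only concerns those of finite degree. *)
Definition is_mdeg (X : sgraph) (d : nat) : Prop :=
  (exists M : sgraph,
     [/\ median M, isomorphic (Cross M) X & has_degree M d]) /\
  (forall (M : sgraph) (k : nat),
     median M -> isomorphic (Cross M) X -> has_degree M k -> d <= k).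

Definition K_adj (n m : nat) : rel ('I_n + 'I_m) :=
  fun u v => match u, v with
             | inl _, inr _ | inr _, inl _ => true
             | _, _ => false
             end.

Lemma K_adj_sym n m : symmetric (@K_adj n m).
Proof. by move=> [?|?] [?|?]. Qed.

Lemma K_adj_irrefl n m : irreflexive (@K_adj n m).
Proof. by move=> [?|?]. Qed.

Definition K (n m : nat) : sgraph := SGraph (@K_adj_sym n m) (@K_adj_irrefl n m).

(* Main.v *)
Require Import Defs.
From mathcomp Require Import all_boot.
From mathcomp Require Import all_classical.
From mathcomp Require Import zify.

(** All three values are instances of one formula: for n, m >= 1 the median
    degree of K_{n,m} is min(2,n) + min(2,m) ([mdeg_K]).

    Upper bound.  The grid P_{n+1} x P_{m+1} is a median graph.  Its
    Theta-classes are the n gaps between consecutive columns and the m gaps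
    between consecutive rows, and two gaps cross exactly when one is vertical
    and the other horizontal, so its crossing graph is K_{n,m} ([Cross_grid]).
    A vertex has at most min(2,n) horizontal and min(2,m) vertical neighbours
    ([grid_degree_le]).

    Lower bound ([degree_lower_bound]).  Let M be a median graph whose crossing
    graph is K_{n,m}, and call its edges left or right after the part of K_{n,m}
    that contains their Theta-class.  Every left class crosses every right
    class, and in a median graph two edges at a vertex whose classes cross span
    a square ([crossing_square]).  Hence walking along a right edge does not
    change the set of left classes present at the current vertex, and vice
    versa.  Two consequences follow.
    - If n >= 2, some vertex meets two left classes: otherwise the only left
      class at a vertex would propagate along all edges and be the only left
      class of M ([sees_two]).  Likewise on the right.
    - Squares also allow consecutive left and right steps of a walk to be
      exchanged, so any u and w are joined by a walk whose left steps precede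
      its right steps ([run_reorder]).
    Take u meeting min(2,m) right classes and w meeting min(2,n) left classes.
    The turning point of such a walk keeps the right classes of u and already
    has the left classes of w, hence has at least min(2,n) + min(2,m)
    neighbours.

    The metric input on median graphs is expressed through distance
    differences: the edge ab, oriented from a to b, is [parallel] to pq when
    d(a,x) - d(b,x) = d(p,x) - d(q,x) for all x.  Opposite edges of a square are
    parallel because a median graph contains no K_{2,3} ([square_parallel]),
    and edges in relation Theta are parallel up to orientation because a ladder
    of squares joins them ([theta_parallel]). *)

Set Implicit Arguments.
Unset Strict Implicit.
Unset Printing Implicit Defensive.

Local Open Scope classical_set_scope.
Local Open Scope card_scope.

(** * Walks and distances *)

Section Distance.
Variable G : sgraph.
Implicit Types x y z : G.

Lemma walk_cat x y z k l :
  walk_of_size x y k -> walk_of_size y z l -> walk_of_size x z (k + l).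
Proof.
move=> [p [xp <- <-]] [q [yq <- <-]]; exists (p ++ q).
by rewrite cat_path xp last_cat size_cat.
Qed.

Lemma walk_edge x y : adj x y -> walk_of_size x y 1.
Proof. by move=> xy; exists [:: y]; rewrite /= xy. Qed.

Lemma walk_sym x y k : walk_of_size x y k -> walk_of_size y x k.
Proof.
move=> [p [xp lp <-]]; elim: p x xp lp => [|z p IH] x /=.
  by move=> _ <-; exists [::].
move=> /andP[xz zp] lp; have wz := IH z zp lp.
rewrite -addn1; apply: walk_cat wz _; apply: walk_edge.
by rewrite adj_sym.
Qed.

Lemma dist_eq x y k : walk_of_size x y k ->
  (forall l, walk_of_size x y l -> k <= l) -> dist x y = k.
Proof.
move=> wk kmin; rewrite /dist; case: xgetP => [l _ [wl lmin]|none].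
  by apply/eqP; rewrite eqn_leq lmin // kmin.
by case: (none k).
Qed.

Hypothesis G_conn : connected G.

Lemma dist_spec x y :
  walk_of_size x y (dist x y) /\ forall l, walk_of_size x y l -> dist x y <= l.
Proof.
have exw : exists k, `[< walk_of_size x y k >].
  by have [k wk] := G_conn x y; exists k; apply/asboolP.
have [k /asboolP wk kmin] := ex_minnP exw.
have {}kmin l : walk_of_size x y l -> k <= l by move=> /asboolP; apply: kmin.
by rewrite (dist_eq wk kmin).
Qed.

Lemma dist_walk x y : walk_of_size x y (dist x y).
Proof. by case: (dist_spec x y). Qed.

Lemma dist_le x y k : walk_of_size x y k -> dist x y <= k.
Proof. by case: (dist_spec x y) => _; apply. Qed.

Lemma distC x y : dist x y = dist y x.
Proof.
by apply/eqP; rewrite eqn_leq; apply/andP; split; apply/dist_le/walk_sym/dist_walk.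
Qed.

Lemma dist_triangle y x z : dist x z <= dist x y + dist y z.
Proof. by apply/dist_le/walk_cat; apply: dist_walk. Qed.

Lemma distxx x : dist x x = 0.
Proof. by apply/eqP; rewrite -leqn0; apply: dist_le; exists [::]. Qed.

Lemma dist0 x y : dist x y = 0 -> x = y.
Proof. by have [p [_ + <-]] := dist_walk x y => + /size0nil E; rewrite E. Qed.

Lemma dist1 x y : dist x y = 1 -> adj x y.
Proof.
have [p [xp lp sp]] := dist_walk x y => d1; rewrite d1 in sp.
by case: p xp lp sp => [|z [|? p]] //= /andP[xz _] <-.
Qed.

Lemma dist_adj x y : adj x y -> dist x y = 1.
Proof.
move=> xy; have /dist_le := walk_edge xy.
case: (dist x y) (@dist0 x y) => [/(_ erefl) exy|[|k] //].
by rewrite exy adj_irrefl in xy.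
Qed.

Lemma dist_step x y k : dist x y = k.+1 -> exists2 z, adj x z & dist z y = k.
Proof.
have [p [xp lp sp]] := dist_walk x y => dk.
case: p xp lp sp => [|z p] /=; first by rewrite dk.
move=> /andP[xz zp] lp sp; exists z => //.
have : dist z y <= k by apply: dist_le; exists p; split=> //; lia.
have := dist_triangle z x y; rewrite (dist_adj xz); lia.
Qed.

End Distance.

(** A way to compute distances: the Lipschitz condition bounds the length of
    walks from below, and repeated descent produces a walk that attains the
    bound. *)
Lemma dist_char (G : sgraph) (D : G -> G -> nat) :
    (forall x z, D x z = 0 -> x = z) -> (forall z, D z z = 0) ->
    (forall x y z, adj x y -> D x z <= (D y z).+1) ->
    (forall x z k, D x z = k.+1 -> exists2 y, adj x y & D y z = k) ->
  connected G /\ forall x y, dist x y = D x y.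
Proof.
move=> D0 Dzz Dlip Dstep.
have walkD x z : walk_of_size x z (D x z).
  move Dk: (D x z) => k; elim: k x Dk => [x /D0 ->|k IH x /Dstep[y xy /IH wy]].
    by exists [::].
  by rewrite -add1n; apply: walk_cat wy; apply: walk_edge.
split=> [x y|x z]; first by exists (D x y).
apply: dist_eq => // l [p [+ + <-]].
elim: p x => [|y p IH] x /=; first by move=> _ ->; rewrite Dzz.
move=> /andP[/(Dlip _ _ z) xy yp] lp; apply: leq_trans xy _.
by rewrite ltnS; apply: IH.
Qed.

(** * Theta-classes and squares of median graphs *)

Section Theta.
Variable M : sgraph.
Implicit Types a b p q r s v x y z : M.

Definition cls a b : set (set M) := [set f | theta [set a; b] f].

(** Equality of the distance differences d(a,x) - d(b,x) and d(p,x) - d(q,x),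
    stated without subtraction in nat. It is oriented, so it compares the
    halfspace of a with that of p. *)
Definition parallel a b p q :=
  forall x, dist a x + dist q x = dist b x + dist p x.

Lemma parallel_sym a b p q : parallel a b p q -> parallel p q a b.
Proof. by move=> abpq x; have := abpq x; lia. Qed.

Lemma parallel_flip a b p q : parallel a b p q -> parallel b a q p.
Proof. by move=> abpq x; have := abpq x; lia. Qed.

Lemma parallel_trans p q a b r s :
  parallel a b p q -> parallel p q r s -> parallel a b r s.
Proof. by move=> abpq pqrs x; have := abpq x; have := pqrs x; lia. Qed.

Lemma set2_eq a b x y :
  [set a; b] = [set x; y] -> (a = x /\ b = y) \/ (a = y /\ b = x).
Proof.
move=> E.
have : [set x; y] a by rewrite -E; left.
have : [set x; y] b by rewrite -E; right.
have : [set a; b] x by rewrite E; left.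
have : [set a; b] y by rewrite E; right.
move=> /= [] ? [] ? [] ? [] ?; subst; by [left | right].
Qed.

(** The defining inequality of Theta does not change when the endpoints of
    either edge are swapped, so it can be tested on any naming of the
    endpoints. *)
Lemma thetaE a b x y : connected M -> adj a b -> adj x y ->
  theta [set a; b] [set x; y] <-> dist a x + dist b y <> dist a y + dist b x.
Proof.
move=> conn ab xy; split; last by exists a, b, x, y.
move=> [a' [b' [x' [y' [_ _ /set2_eq+ /set2_eq]]]]].
by move=> [[-> ->]|[-> ->]] [[-> ->]|[-> ->]]; lia.
Qed.

Lemma clsC a b : cls a b = cls b a.
Proof. by rewrite /cls setUC. Qed.

Lemma cls_theta a b x y : connected M -> adj a b ->
  cls a b [set x; y] -> adj x y ->
  dist a x + dist b y <> dist a y + dist b x.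
Proof. by move=> conn ab + xy; rewrite /cls /= thetaE. Qed.

Lemma cls_refl a b : connected M -> adj a b -> cls a b [set a; b].
Proof.
move=> conn ab; rewrite /cls /= thetaE //.
by rewrite !distxx // (distC conn b a) (dist_adj conn ab).
Qed.

(** Membership of xy in the class of ab asks whether the distance difference
    of ab varies between x and y, and parallel edges have the same
    difference. *)
Lemma cls_parallel a b p q : connected M -> adj a b -> adj p q ->
  parallel a b p q -> cls a b = cls p q.
Proof.
move=> conn.
suff sub c d r s : adj c d -> adj r s -> parallel c d r s -> cls c d `<=` cls r s.
  by move=> ab pq par; rewrite eqEsubset; split; apply: sub => //; apply: parallel_sym.
move=> cd rs par f f_cd.
have [_ [_ [x [y [_ xy _ fE _]]]]] := f_cd; rewrite fE in f_cd *.
rewrite /cls /= thetaE //; have := cls_theta conn cd f_cd xy.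
by have := par x; have := par y; lia.
Qed.

Hypothesis M_median : median M.

Let conn : connected M := proj1 M_median.

Lemma median_ex x1 x2 x3 : exists m,
  [/\ dist x1 x2 = dist x1 m + dist m x2, dist x2 x3 = dist x2 m + dist m x3 &
      dist x1 x3 = dist x1 m + dist m x3].
Proof. by have [m [Pm _]] := proj2 M_median x1 x2 x3; exists m. Qed.

(** Median graphs are bipartite: the median of the two ends of an edge and x
    is one of the ends. *)
Lemma edge_dist a b x : adj a b ->
  dist a x = (dist b x).+1 \/ dist b x = (dist a x).+1.
Proof.
move=> /(dist_adj conn) ab; have [m] := median_ex a b x.
rewrite ab; case Em: (dist a m) => [|k] [abm bx ax].
  by move/(dist0 conn): Em => ?; subst m; rewrite distC // in ab; lia.
have mb : dist m b = 0 by lia.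
by move/(dist0 conn): mb => ?; subst m; lia.
Qed.

Lemma dist_fork v a b : adj v a -> adj v b -> a <> b -> dist a b = 2.
Proof.
move=> va vb ab.
have := dist_triangle conn v a b.
rewrite (distC conn a v) (dist_adj conn va) (dist_adj conn vb).
case E: (dist a b) => [|[|[|k]]] //; first by move/(dist0 conn): E.
move/(dist1 conn): E => /(edge_dist v).
by rewrite !(distC conn _ v) (dist_adj conn va) (dist_adj conn vb); lia.
Qed.

(** The quadrangle condition; m is the median of a, b and z. *)
Lemma quadrangle v a b z : adj v a -> adj v b -> a <> b ->
    dist v z = (dist a z).+1 -> dist v z = (dist b z).+1 ->
  exists m, [/\ adj a m, adj b m & dist v z = (dist m z).+2].
Proof.
move=> va vb ab az bz; have ab2 := dist_fork va vb ab.
have [m [abm bzm azm]] := median_ex a b z.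
rewrite (distC conn m b) in abm.
by exists m; split; [apply: dist1 => //; lia | apply: dist1 => //; lia | lia].
Qed.

(** The hypotheses would give a third common neighbour z of a and b by the
    quadrangle condition, and then both a and b would be medians of v, m and
    z. *)
Lemma no_K23 v a m b x : adj v a -> adj a m -> adj m b -> adj b v ->
    a <> b -> v <> m ->
    dist v x = (dist a x).+1 -> dist v x = (dist b x).+1 ->
    dist m x = (dist a x).+1 -> False.
Proof.
move=> va am mb bv neq_ab neq_vm vax vbx max.
have vb : adj v b by rewrite adj_sym.
have [z [az bz vz]] := quadrangle va vb neq_ab vax vbx.
have vz2 : v <> z by move=> E; move: vz; rewrite E; lia.
have mz2 : m <> z by move=> E; move: vz; rewrite -E; lia.
have med c : adj v c -> adj c m -> adj c z ->
  [/\ dist v m = dist v c + dist c m, dist m z = dist m c + dist c z &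
      dist v z = dist v c + dist c z].
  move=> vc cm cz; have cv : adj c v by rewrite adj_sym.
  have mc : adj m c by rewrite adj_sym.
  rewrite (dist_fork cv cm) // (dist_fork cm cz) // (dist_fork cv cz) //.
  by rewrite (dist_adj conn vc) (dist_adj conn cm) (dist_adj conn mc) (dist_adj conn cz).
have [w [_ uniq_w]] := proj2 M_median v m z.
have bm : adj b m by rewrite adj_sym.
by case: neq_ab; rewrite -(uniq_w a (med a va am az)) (uniq_w b (med b vb bm bz)).
Qed.

(** By bipartiteness each distance difference is 1 or -1. If they disagreed
    at x, two opposite corners would be equally far from x and both other
    corners one step further, which is the configuration excluded above. *)
Lemma square_parallel v a m b :
    adj v a -> adj a m -> adj m b -> adj b v -> a <> b -> v <> m ->
  parallel v a b m.
Proof.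
move=> va am mb bv neq_ab neq_vm x.
have bad1 := @no_K23 v a m b x va am mb bv neq_ab neq_vm.
have bad2 : dist a x = (dist v x).+1 -> dist a x = (dist m x).+1 ->
    dist b x = (dist v x).+1 -> False.
  by apply: (@no_K23 a v b m x); rewrite // adj_sym.
have := edge_dist x va; have := edge_dist x am.
have := edge_dist x mb; have := edge_dist x bv; lia.
Qed.

(** Induction on the distance from pq to va: one step from p towards v and a
    quadrangle on the other side give a square with pq as a rung, whose
    opposite edge is closer to va. *)
Lemma ladder k v a p q : adj v a -> adj p q ->
    dist p v = k -> dist q a = k -> dist p a = k.+1 -> dist q v = k.+1 ->
  parallel v a p q.
Proof.
move=> va; elim: k p q => [|k IH] p q pq pv qa pa qv.
  by move/(dist0 conn): pv => ->; move/(dist0 conn): qa => -> x; lia.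
have [p' pp' p'v] := dist_step conn pv.
have av := dist_adj conn va.
have p'a : dist p' a = k.+1.
  by have := dist_triangle conn p' p a; have := dist_triangle conn v p' a; rewrite (dist_adj conn pp'); lia.
have neq_p'q : p' <> q by move=> E; move: p'v; rewrite E; lia.
have [||q' [p'q' qq' pq'a]] := quadrangle (z := a) pp' pq neq_p'q; try lia.
have q'v : dist q' v = k.+1.
  have := dist_triangle conn p' q' v; have := dist_triangle conn q' q v.
  by rewrite (dist_adj conn qq') (distC conn q' p') (dist_adj conn p'q'); lia.
have par : parallel v a p' q' by apply: IH => //; lia.
have q'q : adj q' q by rewrite adj_sym.
have qp : adj q p by rewrite adj_sym.
apply: parallel_trans par _; apply: parallel_sym.
apply: (@square_parallel p q q' p'); rewrite // 1?adj_sym //.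
- by move=> E; apply: neq_p'q.
- by move=> E; move: pq'a; rewrite E; lia.
Qed.

(** By bipartiteness the inequality means that one end of pq is nearer to v
    and the other nearer to a, and by the same amount. *)
Lemma theta_parallel v a p q : adj v a -> adj p q ->
    dist v p + dist a q <> dist v q + dist a p ->
  parallel v a p q \/ parallel v a q p.
Proof.
move=> va pq neq.
have qp : adj q p by rewrite adj_sym.
have := edge_dist p va; have := edge_dist q va.
have := edge_dist v pq; have := edge_dist a pq.
move: neq (@ladder (dist p v) v a p q va pq) (@ladder (dist q v) v a q p va qp).
rewrite !(distC conn v) !(distC conn a) => neq L1 L2 D1 D2 D3 D4.
by have [lt|le] := ltnP (dist p v) (dist q v); [left; apply: L1 | right; apply: L2]; lia.
Qed.

(** Parallel up to orientation, the form in which Theta is used below. *)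
Definition along v a p q := parallel v a p q \/ parallel v a q p.

Lemma cls_along v a p q : adj v a -> adj p q -> along v a p q -> cls v a = cls p q.
Proof.
move=> va pq [] par; first exact: cls_parallel.
by rewrite (clsC p); apply: cls_parallel => //; rewrite adj_sym.
Qed.

Lemma squareP p q r s : square p q r s ->
  [/\ adj p q, adj q r, adj r s & adj s p] /\ p <> r /\ q <> s.
Proof. by move=> [/and4P]. Qed.

(** Opposite edges of a square are parallel, so two adjacent edges represent
    all four. *)
Lemma class_in_square v a p q r s : adj v a -> square p q r s ->
  cls v a `&` square_edges p q r s !=set0 -> along v a p q \/ along v a q r.
Proof.
move=> va /squareP[[pq qr rs sp] [pr qs]] [e [e_va e_sq]].
have theta_va x y : adj x y -> e = [set x; y] -> along v a x y.
  move=> xy E; rewrite E in e_va.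
  by apply: theta_parallel => //; apply: cls_theta e_va xy.
have ps : adj p s by rewrite adj_sym.
have par1 : parallel p q s r.
  by apply: (@square_parallel p q r s).
have par2 : parallel q r p s.
  by apply: (@square_parallel q r s p) => //; apply: nesym.
case: e_sq => /theta_va.
- by move=> /(_ pq); left.
- by move=> /(_ qr); right.
- move=> /(_ rs) [] par; left; [right | left]; apply: parallel_trans par _.
    exact/parallel_flip/parallel_sym.
  exact/parallel_sym.
- move=> /(_ sp) [] par; right; [right | left]; apply: parallel_trans par _.
    exact/parallel_flip/parallel_sym.
  exact/parallel_sym.
Qed.

(** The classes of va and vb cut the square both ways, so its four corners
    realize all four pairs of sides, in particular the one beyond both a and
    b. *)
Lemma square_corner v a b p q r s : square p q r s ->
    along v a p q -> along v b q r ->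
  exists z, dist v z = (dist a z).+1 /\ dist v z = (dist b z).+1.
Proof.
move=> /squareP[[pq qr rs sp] [neq_pr neq_qs]] Va Vb.
have qp : adj q p by rewrite adj_sym.
have ps : adj p s by rewrite adj_sym.
have sr : adj s r by rewrite adj_sym.
have rq : adj r q by rewrite adj_sym.
have rp2 := dist_fork qp qr neq_pr; have pr2 := rp2; rewrite distC // in rp2.
have qs2 := dist_fork pq ps neq_qs; have sq2 := qs2; rewrite distC // in sq2.
have adj1 := @dist_adj M conn.
have D := (adj1 _ _ pq, adj1 _ _ qp, adj1 _ _ qr, adj1 _ _ rq, adj1 _ _ rs,
  adj1 _ _ sr, adj1 _ _ sp, adj1 _ _ ps, distxx conn, rp2, pr2, qs2, sq2).
case: Va => Va; case: Vb => Vb.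
- by exists r; have := Va r; have := Vb r; rewrite !D //; lia.
- by exists q; have := Va q; have := Vb q; rewrite !D //; lia.
- by exists s; have := Va s; have := Vb s; rewrite !D //; lia.
- by exists p; have := Va p; have := Vb p; rewrite !D //; lia.
Qed.

(** A square witnessing the crossing may be far from v. One of its corners z
    lies beyond both edges as seen from v, and the quadrangle condition for
    v, a, b and z brings a square back to v. *)
Lemma crossing_square v a b : adj v a -> adj v b ->
    crosses (cls v a) (cls v b) ->
  exists m, [/\ adj a m, adj b m, cls b m = cls v a & cls a m = cls v b].
Proof.
move=> va vb [neq_cls [p [q [r [s [sq ha hb]]]]]].
have [[pq qr _ _] _] := squareP sq.
have [z [az bz]] : exists z, dist v z = (dist a z).+1 /\ dist v z = (dist b z).+1.
  case: (class_in_square va sq ha) (class_in_square vb sq hb) => Va [] Vb.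
  - by case: neq_cls; rewrite (cls_along va pq Va) (cls_along vb pq Vb).
  - exact: (square_corner sq Va Vb).
  - by have [z [? ?]] := square_corner sq Vb Va; exists z.
  - by case: neq_cls; rewrite (cls_along va qr Va) (cls_along vb qr Vb).
have neq_ab : a <> b by move=> E; apply: neq_cls; rewrite E.
have [m [am bm mz]] := quadrangle va vb neq_ab az bz.
have neq_vm : v <> m by move=> E; move: mz; rewrite E; lia.
have mb : adj m b by rewrite adj_sym.
have ma : adj m a by rewrite adj_sym.
have bv : adj b v by rewrite adj_sym.
have av : adj a v by rewrite adj_sym.
exists m; split=> //; symmetry; apply: cls_parallel => //.
  exact: square_parallel.
by apply: square_parallel => //; apply: nesym.
Qed.

End Theta.

(** * Reordering walks in a graph with two kinds of edges *)

Lemma card_le_inj (T U : Type) (A : set T) (B : set U) (f : T -> U) :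
    (forall x, A x -> B (f x)) ->
    (forall x y, A x -> A y -> f x = f y -> x = y) ->
  A #<= B.
Proof.
move=> fB f_inj; apply/card_subP; exists (f @` A); last by move=> _ [x /fB ? <-].
by apply: inj_card_eq => x y; rewrite !inE; apply: f_inj.
Qed.

(** T stands for the set of Theta-classes, each on one of two sides, and
    edge c x y for xy being an edge of class c. Of the median graph only
    connectedness and the squares spanned by edges of different sides enter
    the combinatorial part of the lower bound. *)
Section TwoSidedColouring.
Variables (M : sgraph) (T : eqType) (side : T -> bool).
Variable edge : T -> M -> M -> Prop.

Hypothesis M_conn : connected M.
Hypothesis edge_adj : forall c x y, edge c x y -> adj x y.
Hypothesis adj_edge : forall x y, adj x y -> exists c, edge c x y.
Hypothesis edge_sym : forall c x y, edge c x y -> edge c y x.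
Hypothesis edge_inj : forall c d x y, edge c x y -> edge d x y -> c = d.
Hypothesis edge_ex : forall c, exists x y, edge c x y.
Hypothesis edge_square : forall c d v a b, side c != side d ->
  edge c v a -> edge d v b -> exists2 m, edge c b m & edge d a m.

Definition sees x c := exists y, edge c x y.

(** At least k classes of one side at x. Classes rather than neighbours are
    counted because squares transport classes; distinct classes give distinct
    neighbours. *)
Definition rich s k x :=
  exists2 h : 'I_k -> T, injective h & forall i, side (h i) = s /\ sees x (h i).

Inductive run (s : bool) (x : M) : M -> Prop :=
| run0 : run s x x
| run_step y z c : side c = s -> edge c x y -> run s y z -> run s x z.

(** The square spanned by two edges at x of different sides has an edge of
    class c at y, opposite to the one at x. *)
Lemma sees_step c d x y : side c != side d -> edge d x y -> sees x c -> sees y c.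
Proof.
move=> cd xy [z xz]; have [m ym _] := edge_square cd xz xy.
by exists m.
Qed.

Lemma rich_run s k x y : run (~~ s) x y -> rich s k x <-> rich s k y.
Proof.
elim=> {x y} // x y z c sc xy _ <-.
split=> -[h h_inj hP]; exists h => // i; have [si xi] := hP i; split=> //.
  by apply: sees_step xy xi; rewrite si sc; case: (s).
by apply: sees_step (edge_sym xy) xi; rewrite si sc; case: (s).
Qed.

(** Induction along the run: the edge xu is pushed across one square after
    another, giving a translate of the run that starts at u. *)
Lemma run_swap s c u x y : side c != s -> edge c x u -> run s x y ->
  exists2 z, run s u z & edge c y z.
Proof.
move=> cs xu xy; elim: xy u xu => {x y} [x|x y z d sd xy _ IH] u xu.
  by exists u => //; apply: run0.
have cd : side c != side d by rewrite sd.
have [m ym um] := edge_square cd xu xy.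
have [w mw zw] := IH m ym.
by exists w => //; apply: run_step sd um mw.
Qed.

(** Induction on a walk from u to w: a first step of the wrong side is moved
    behind the run that follows it. *)
Lemma run_reorder u w : exists2 y, run true u y & run false y w.
Proof.
have [k [p [up <- _]]] := M_conn u w.
elim: p u up => [|x p IH] u /=; first by exists u; apply: run0.
move=> /andP[/adj_edge[c ux] /IH[y xy yw]].
case sc : (side c); first by exists y => //; apply: run_step sc ux xy.
have [|z uz yz] := run_swap _ (edge_sym ux) xy; first by rewrite sc.
by exists z => //; apply: run_step sc (edge_sym yz) yw.
Qed.

(** If no vertex had two classes on this side, then c would spread from u to
    every vertex: a step of the other side keeps it, and a step of the same
    side has class c. At an end of an edge of class d this leaves only c = d. *)
Lemma sees_two c d : c != d -> side c = side d ->
  exists x, rich (side c) 2 x.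
Proof.
move=> neq_cd scd; have [u [u' uu']] := edge_ex c; have [w [w' ww']] := edge_ex d.
apply: contrapT => poor.
have only x c1 c2 : side c1 = side c -> side c2 = side c ->
    sees x c1 -> sees x c2 -> c1 = c2.
  move=> s1 s2 x1 x2; apply: contrapT => /eqP neq12; apply: poor; exists x.
  exists (fun i : 'I_2 => if i == ord0 then c1 else c2) => [i j|i].
    case: i j => [[|[|//]] ?] [[|[|//]] ?] //= E; try exact: val_inj.
      by rewrite E eqxx in neq12.
    by rewrite E eqxx in neq12.
  by case: ifP.
have sees_c : sees w c.
  have : sees u c by exists u'.
  have [k [p [up <- _]]] := M_conn u w.
  elim: p u up {uu'} => [//|x p IH] u /= /andP[/adj_edge[e ux] xp] uc.
  apply: IH xp _; have [se|se] := eqVneq (side c) (side e).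
    by rewrite (only u c e) //; [exists u; apply: edge_sym | exists x].
  exact: sees_step se ux uc.
have E : c = d by apply: (only w) => //; exists w'.
by rewrite E eqxx in neq_cd.
Qed.

Lemma rich_ex s k (h : 'I_k -> T) : 0 < k <= 2 -> injective h ->
  (forall i, side (h i) = s) -> exists x, rich s k x.
Proof.
case: k h => [|[|[|//]]] // h _ h_inj hs.
  have [x [y xy]] := edge_ex (h ord0); exists x, h => // i.
  by rewrite (ord1 i); split=> //; exists y.
have [|x] := @sees_two (h ord0) (h ord_max) _ (etrans (hs _) (esym (hs _))).
  by apply/eqP => /h_inj.
by rewrite hs; exists x.
Qed.

(** The turning point of a reordered walk from u to w is separated from u by
    true-sided steps, which keep false-sided classes, and from w by
    false-sided steps. *)
Lemma rich_both k l (h : 'I_k -> T) (h' : 'I_l -> T) :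
    0 < k <= 2 -> 0 < l <= 2 -> injective h -> injective h' ->
    (forall i, side (h i)) -> (forall i, side (h' i) = false) ->
  exists x, rich true k x /\ rich false l x.
Proof.
move=> k2 l2 h_inj h'_inj hs h's.
have [w w_rich] := rich_ex k2 h_inj hs; have [u u_rich] := rich_ex l2 h'_inj h's.
have [y uy yw] := run_reorder u w.
by exists y; rewrite (rich_run (s := true) _ yw) -(rich_run (s := false) _ uy).
Qed.

Lemma rich_degree k l x d :
  rich true k x -> rich false l x -> degree_le M d -> k + l <= d.
Proof.
move=> [h h_inj hP] [h' h'_inj h'P] /(_ x) deg.
pose g (i : 'I_k + 'I_l) := match i with inl i => h i | inr i => h' i end.
have g_inj : injective g.
  move=> [i|i] [j|j] //= E; first by rewrite (h_inj _ _ E).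
  - by have := proj1 (hP i); rewrite E (proj1 (h'P j)).
  - by have := proj1 (hP j); rewrite -E (proj1 (h'P i)).
  - by rewrite (h'_inj _ _ E).
have /choice[nb nbP] : forall i, exists y, edge (g i) x y.
  by case=> i /=; [have [] := hP i | have [] := h'P i].
pose f (i : 'I_(k + l)) := nb (fintype.split i).
have f_inj : injective f.
  move=> i j E; apply: (can_inj fintype.splitK); apply: g_inj.
  by apply: edge_inj (nbP _) _; rewrite [nb _]E; apply: nbP.
rewrite -card_le_II (card_le_eql card_II); apply: card_le_trans deg.
apply: (card_le_inj (f := f)) => [i _|i j _ _ /f_inj //].
exact: edge_adj (nbP _).
Qed.

End TwoSidedColouring.

(** * The lower bound *)

(** The two sides are the two parts of the complete bipartite graph; an edge
    has colour c when its Theta-class corresponds to c under the isomorphism. *)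
Lemma degree_lower_bound n m (M : sgraph) d : 0 < n -> 0 < m ->
    median M -> isomorphic (Cross M) (K n m) -> degree_le M d ->
  minn 2 n + minn 2 m <= d.
Proof.
move=> n0 m0 M_median [f [g fK gK] f_adj] deg.
have conn : connected M by case: M_median.
pose side (c : 'I_n + 'I_m) := if c is inl _ then true else false.
pose edge (c : 'I_n + 'I_m) (x y : M) := adj x y /\ cls x y = proj1_sig (g c).
have g_inj c c' : proj1_sig (g c) = proj1_sig (g c') -> c = c'.
  move=> E; apply: (can_inj gK).
  by case: (g c) (g c') E => [C hC] [C' hC'] /= E; apply: eq_exist.
have edge_adj c x y : edge c x y -> adj x y by case.
have adj_edge x y : adj x y -> exists c, edge c x y.
  move=> xy; have C : theta_class (cls x y).
    by exists [set x; y] => //; exists x, y.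
  by exists (f (exist _ (cls x y) C)); rewrite /edge fK.
have edge_sym c x y : edge c x y -> edge c y x.
  by rewrite /edge adj_sym clsC.
have edge_inj c c' x y : edge c x y -> edge c' x y -> c = c'.
  by move=> [_ E] [_ E']; apply: g_inj; rewrite -E.
have edge_ex c : exists x y, edge c x y.
  rewrite /edge; case: (g c) => C /= [_ [x [y [xy ->]]] ->].
  by exists x, y.
have edge_square c d' v a b : side c != side d' -> edge c v a -> edge d' v b ->
    exists2 w, edge c b w & edge d' a w.
  move=> cd' [va Ea] [vb Eb].
  have : crosses (cls v a) (cls v b).
    rewrite Ea Eb; apply/asboolP.
    change (adj (g c) (g d')); rewrite -f_adj !gK.
    by case: c d' cd' {Ea Eb} => [i|i] [j|j].
  by move=> /(crossing_square M_median va vb)[w [aw bw E1 E2]]; exists w; split=> //; congruence.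
have widen k : minn 2 k <= k by lia.
pose left i : 'I_n + 'I_m := inl (widen_ord (widen n) i).
pose right i : 'I_n + 'I_m := inr (widen_ord (widen m) i).
have left_inj : injective left by move=> i j [E]; apply: val_inj.
have right_inj : injective right by move=> i j [E]; apply: val_inj.
have [||//|//|x [x_rich x_rich']] := rich_both conn adj_edge edge_sym edge_ex
  edge_square _ _ left_inj right_inj; try lia.
exact: (rich_degree edge_adj edge_inj x_rich x_rich').
Qed.

(** * The grid *)

Section Grid.
Variables n m : nat.

Definition line_dist (i j : nat) := (i - j) + (j - i).

Definition grid_dist (x y : 'I_n.+1 * 'I_m.+1) :=
  line_dist x.1 y.1 + line_dist x.2 y.2.

Definition grid_adj : rel ('I_n.+1 * 'I_m.+1) := fun x y => grid_dist x y == 1.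

Lemma line_distC i j : line_dist i j = line_dist j i.
Proof. exact: addnC. Qed.

Lemma line_dist0 i j : line_dist i j = 0 -> i = j.
Proof. by rewrite /line_dist; lia. Qed.

Lemma line_dist_triangle i j k : line_dist i k <= line_dist i j + line_dist j k.
Proof. by rewrite /line_dist; lia. Qed.

(** If k = 1, truncation by k.-1 identifies left and right: i then has a
    single neighbour among 0 and 1. *)
Lemma line_code k i j l : i <= k -> j <= k -> l <= k ->
    line_dist i j = 1 -> line_dist i l = 1 ->
  minn (i < j) k.-1 = minn (i < l) k.-1 -> j = l.
Proof. by rewrite /line_dist; lia. Qed.

Lemma grid_adj_sym : symmetric grid_adj.
Proof.
by move=> x y; rewrite /grid_adj /grid_dist line_distC (line_distC x.2).
Qed.

Lemma grid_adj_irrefl : irreflexive grid_adj.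
Proof. by move=> x; rewrite /grid_adj /grid_dist /line_dist !subnn. Qed.

Definition grid : sgraph := SGraph grid_adj_sym grid_adj_irrefl.

Lemma pair_ord_inj (x y : grid) :
  x.1 = y.1 :> nat -> x.2 = y.2 :> nat -> x = y.
Proof. by case: x y => [? ?] [? ?] /= /val_inj-> /val_inj->. Qed.

Lemma line_step k (i j : 'I_k.+1) d : line_dist i j = d.+1 ->
  exists2 i' : 'I_k.+1, line_dist i i' = 1 & line_dist i' j = d.
Proof.
rewrite /line_dist => ij; have ltik := ltn_ord i; have ltjk := ltn_ord j.
exists (inord (if i < j then i.+1 else i.-1)); rewrite inordK; case: ifP; lia.
Qed.

Lemma grid_connected_dist :
  connected grid /\ forall x y : grid, dist x y = grid_dist x y.
Proof.
apply: dist_char => [x z|z|x y z|x z k].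
- rewrite /grid_dist => D0.
  by apply: pair_ord_inj; apply: line_dist0; lia.
- by rewrite /grid_dist /line_dist !subnn.
- move=> /eqP; rewrite /grid_dist.
  have := line_dist_triangle x.1 y.1 z.1.
  by have := line_dist_triangle x.2 y.2 z.2; lia.
- rewrite /grid_dist; case E1: (line_dist x.1 z.1) => [|d] E.
    have [j xj jz] := line_step E; exists (x.1, j).
      by rewrite /= /grid_adj /grid_dist /= xj /line_dist subnn.
    by rewrite /= E1 jz.
  have [i xi iz] := line_step E1; exists (i, x.2).
    by rewrite /= /grid_adj /grid_dist /= xi /line_dist subnn.
  by rewrite /= iz; lia.
Qed.

(** The median of three numbers is the middle one; the equivalence also
    records uniqueness. *)
Lemma line_median k (a b c : 'I_k.+1) : exists p : 'I_k.+1,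
  forall q : 'I_k.+1, p = q <->
  [/\ line_dist a b = line_dist a q + line_dist q b,
      line_dist b c = line_dist b q + line_dist q c &
      line_dist a c = line_dist a q + line_dist q c].
Proof.
have := ltn_ord a; have := ltn_ord b; have := ltn_ord c => ltc ltb lta.
exists (inord (maxn (minn a b) (minn c (maxn a b)))) => q.
have -> : (inord (maxn (minn a b) (minn c (maxn a b))) = q) <->
    maxn (minn a b) (minn c (maxn a b)) = q :> nat.
  split=> [<-|E]; first by rewrite inordK //; lia.
  by apply: val_inj; rewrite /= inordK //; lia.
rewrite /line_dist; split=> [E|[]]; last lia.
by split; lia.
Qed.

(** The three sums of the metric condition split coordinatewise by the
    triangle inequality, so medians are taken in each factor. *)
Lemma grid_median : median grid.
Proof.
have [conn distE] := grid_connected_dist; split=> // a b c.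
have [p1 p1P] := line_median a.1 b.1 c.1; have [p2 p2P] := line_median a.2 b.2 c.2.
exists (p1, p2); split.
  rewrite !distE /grid_dist /=.
  have [-> -> ->] := (p1P p1).1 erefl; have [-> -> ->] := (p2P p2).1 erefl.
  by split; lia.
move=> q; rewrite !distE /grid_dist.
have T1 i j := line_dist_triangle i q.1 j; have T2 i j := line_dist_triangle i q.2 j.
have := T1 a.1 b.1; have := T1 a.1 c.1; have := T1 b.1 c.1.
have := T2 a.2 b.2; have := T2 a.2 c.2; have := T2 b.2 c.2.
move=> ? ? ? ? ? ? [? ? ?].
have E1 : p1 = q.1 by apply/p1P; split; lia.
have E2 : p2 = q.2 by apply/p2P; split; lia.
by rewrite E1 E2; apply: pair_ord_inj.
Qed.

End Grid.

(** * Theta-classes and degree of the grid *)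

Section GridClasses.
Variables n m : nat.
Notation G := (grid n m).
Implicit Types (c d : 'I_n + 'I_m) (p q r s x y : G).

Let conn : connected G := proj1 (grid_connected_dist n m).
Let distE : forall x y : G, dist x y = grid_dist x y :=
  proj2 (grid_connected_dist n m).

(** Colours index the gaps between consecutive columns (inl) or rows (inr); y
    is the end with the larger coordinate. *)
Definition links c x y : Prop :=
  match c with
  | inl i => [/\ x.1 = i :> nat, y.1 = i.+1 :> nat & x.2 = y.2 :> nat]
  | inr j => [/\ x.2 = j :> nat, y.2 = j.+1 :> nat & x.1 = y.1 :> nat]
  end.

Definition crosses_gap c x y := links c x y \/ links c y x.

Definition lo c : G :=
  match c with
  | inl i => (widen_ord (leqnSn n) i, ord0)
  | inr j => (ord0, widen_ord (leqnSn m) j)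
  end.

Definition hi c : G :=
  match c with
  | inl i => (lift ord0 i, ord0)
  | inr j => (ord0, lift ord0 j)
  end.

Lemma links_lo_hi c : links c (lo c) (hi c).
Proof. by case: c. Qed.

Lemma links_adj c x y : links c x y -> adj x y.
Proof.
by case: c => i [E1 E2 E3]; rewrite /= /grid_adj /grid_dist /line_dist; lia.
Qed.

Lemma adj_crosses_gap x y : adj x y -> exists c, crosses_gap c x y.
Proof.
case: x y => [x1 x2] [y1 y2] /eqP; rewrite /grid_dist /line_dist /= => xy.
have hx1 := ltn_ord x1; have hy1 := ltn_ord y1.
have hx2 := ltn_ord x2; have hy2 := ltn_ord y2.
have [E|neq1] := eqVneq (x1 : nat) y1.
  have lt : minn x2 y2 < m by lia.
  exists (inr (Ordinal lt)); case: (boolP (x2 <= y2)) => le; [left|right]; split=> /=; lia.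
have lt : minn x1 y1 < n by lia.
exists (inl (Ordinal lt)); case: (boolP (x1 <= y1)) => le; [left|right]; split=> /=; lia.
Qed.

Lemma links_parallel c x y p q : links c x y -> links c p q -> parallel x y p q.
Proof.
move=> xy pq z; rewrite !distE /grid_dist.
by case: c xy pq => i [E1 E2 E3] [F1 F2 F3]; rewrite E1 E2 E3 F1 F2 F3; lia.
Qed.

(** If both gaps are in the same direction, both ends of pq lie on one side
    of the gap c; if the directions differ, the distance difference of xy
    depends on one coordinate only, which p and q share. *)
Lemma links_not_theta c d x y p q : links c x y -> links d p q -> c <> d ->
  dist x p + dist y q = dist x q + dist y p.
Proof.
move=> xy pq cd; rewrite !distE /grid_dist.
case: c d xy pq cd => i [] j [E1 E2 E3] [F1 F2 F3] cd; rewrite E1 E2 E3 F1 F2 F3.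
- have neq : nat_of_ord i <> j by move=> /val_inj E; apply: cd; rewrite E.
  by rewrite /line_dist; lia.
- lia.
- lia.
- have neq : nat_of_ord i <> j by move=> /val_inj E; apply: cd; rewrite E.
  by rewrite /line_dist; lia.
Qed.

Definition gap_class c : set (set G) := cls (lo c) (hi c).

Lemma gap_class_eq c x y : crosses_gap c x y -> cls x y = gap_class c.
Proof.
have main u v : links c u v -> cls u v = gap_class c.
  move=> uv; have uv_adj := links_adj uv; have lh := links_lo_hi c.
  by apply: cls_parallel => //; [apply: links_adj lh | apply: links_parallel lh].
by case=> /main //; rewrite clsC.
Qed.

Lemma gap_class_inj : injective gap_class.
Proof.
move=> c d E; apply: contrapT => cd.
have c_adj := links_adj (links_lo_hi c); have d_adj := links_adj (links_lo_hi d).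
have : gap_class c [set lo d; hi d] by rewrite E; apply: cls_refl.
move=> /cls_theta-/(_ conn c_adj d_adj); apply.
exact: links_not_theta (links_lo_hi c) (links_lo_hi d) cd.
Qed.

Lemma crosses_gap_eq c d x y : crosses_gap c x y -> crosses_gap d x y -> c = d.
Proof.
by move=> /gap_class_eq c_xy /gap_class_eq; rewrite c_xy; apply: gap_class_inj.
Qed.

Lemma gap_in_square c p q r s : square p q r s ->
  gap_class c `&` square_edges p q r s !=set0 ->
  crosses_gap c p q \/ crosses_gap c q r.
Proof.
move=> sq meets; have [[pq qr _ _] _] := squareP sq.
have lh := links_adj (links_lo_hi c).
have gap_of x y : adj x y -> along (lo c) (hi c) x y -> crosses_gap c x y.
  move=> xy along_xy; have [d d_xy] := adj_crosses_gap xy.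
  suff -> : c = d by [].
  by apply: gap_class_inj; rewrite -(gap_class_eq d_xy) -(cls_along (grid_median n m) lh xy along_xy).
by have [/gap_of|/gap_of] := class_in_square (grid_median n m) lh sq meets; [left|right]; auto.
Qed.

(** Crossing two different gaps of the same direction in succession goes
    straight from p to r over two units, and then q is the only common
    neighbour of p and r. *)
Lemma square_turns c d p q r s :
    crosses_gap c p q -> crosses_gap d q r -> c <> d -> adj r s -> adj s p ->
  q <> s -> K_adj c d.
Proof.
rewrite /= /grid_adj /grid_dist /line_dist.
have straight (i j a b e f a' b' e' f' : nat) : i <> j ->
    (a = i /\ b = i.+1) \/ (b = i /\ a = i.+1) ->
    (b = j /\ e = j.+1) \/ (e = j /\ b = j.+1) ->
    a' = b' -> b' = e' ->
    (e - f) + (f - e) + ((e' - f') + (f' - e')) = 1 ->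
    (f - a) + (a - f) + ((f' - a') + (a' - f')) = 1 ->
  b = f /\ b' = f'.
  by move=> neq [] [Ea Eb] [] [Eb' Ee] E1 E2; lia.
move=> pq qr cd rs sp qs; apply: contraT => not_adj; case: qs.
case: c d pq qr cd not_adj => i [] j //= pq qr cd _.
  have neq : nat_of_ord i <> j by move=> /val_inj E; apply: cd; rewrite E.
  have [||||||E1 E2] := straight i j p.1 q.1 r.1 s.1 p.2 q.2 r.2 s.2 neq; try lia.
  all: try by case: pq => -[]; case: qr => -[]; lia.
  exact: pair_ord_inj.
have neq : nat_of_ord i <> j by move=> /val_inj E; apply: cd; rewrite E.
have [||||||E1 E2] := straight i j p.2 q.2 r.2 s.2 p.1 q.1 r.1 s.1 neq; try lia.
all: try by case: pq => -[]; case: qr => -[]; lia.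
exact: pair_ord_inj.
Qed.

Lemma gap_classes_cross (i : 'I_n) (j : 'I_m) :
  crosses (gap_class (inl i)) (gap_class (inr j)).
Proof.
split; first by move=> /gap_class_inj.
pose i0 := widen_ord (leqnSn n) i; pose i1 := lift ord0 i.
pose j0 := widen_ord (leqnSn m) j; pose j1 := lift ord0 j.
pose a : G := (i0, j0); pose b : G := (i1, j0).
pose c : G := (i1, j1); pose d : G := (i0, j1).
have ab : links (inl i) a b by [].
have bc : links (inr j) b c by [].
have dc : links (inl i) d c by [].
have ad : links (inr j) a d by [].
exists a, b, c, d; split.
- split; first apply/and4P; [split; try by apply: links_adj; eassumption| |].
  + by rewrite adj_sym; apply: links_adj dc.
  + by rewrite adj_sym; apply: links_adj ad.
  + by split=> /(congr1 (fun z : G => z.1 : nat)); rewrite /= /bump; lia.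
  + by rewrite /= /grid_adj /grid_dist /line_dist /= /bump; lia.
- exists [set a; b]; split; last by constructor 1.
  by rewrite -(gap_class_eq (or_introl ab)); apply: cls_refl => //; apply: links_adj ab.
- exists [set b; c]; split; last by constructor 2.
  by rewrite -(gap_class_eq (or_introl bc)); apply: cls_refl => //; apply: links_adj bc.
Qed.

Lemma crosses_gapE c d : crosses (gap_class c) (gap_class d) <-> K_adj c d.
Proof.
split=> [[neq [p [q [r [s [sq meets_c meets_d]]]]]]|].
  have [[_ _ rs sp] [_ qs]] := squareP sq.
  have cd : c <> d by move=> E; apply: neq; rewrite E.
  have [cpq|cqr] := gap_in_square sq meets_c.
    have [dpq|dqr] := gap_in_square sq meets_d; last exact: square_turns cpq dqr cd rs sp qs.
    by case: cd; apply: crosses_gap_eq cpq dpq.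
  have [dpq|dqr] := gap_in_square sq meets_d; last by case: cd; apply: crosses_gap_eq cqr dqr.
  by rewrite K_adj_sym; apply: square_turns dpq cqr (nesym cd) rs sp qs.
case: c d => i [] j // _; first exact: gap_classes_cross.
have [neq [p [q [r [s [sq h1 h2]]]]]] := gap_classes_cross j i.
by split; [apply: nesym | exists p, q, r, s].
Qed.

Lemma gap_class_theta c : theta_class (gap_class c).
Proof.
exists [set lo c; hi c] => //; exists (lo c), (hi c); split=> //.
exact: links_adj (links_lo_hi c).
Qed.

Lemma Cross_grid : isomorphic (Cross G) (K n m).
Proof.
pose g c : Cross G := exist _ (gap_class c) (gap_class_theta c).
have g_inj c d : g c = g d -> c = d by move=> [/gap_class_inj].
have g_surj C : exists c, g c = C.
  case: C => C hC; have [_ [x [y [xy ->]]] E] := hC.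
  have [c /gap_class_eq cxy] := adj_crosses_gap xy.
  by exists c; apply: eq_exist; rewrite -cxy E.
have [f fK] := choice g_surj.
exists f => [|C D]; first by exists g => // c; apply: g_inj; rewrite fK.
rewrite -{2}(fK C) -{2}(fK D); apply/idP/asboolP => /=; by rewrite crosses_gapE.
Qed.

(** Neighbours are numbered injectively: horizontal ones by a number below
    min(2,n), vertical ones by min(2,n) plus a number below min(2,m). *)
Lemma grid_degree_le : 0 < n -> 0 < m -> degree_le G (minn 2 n + minn 2 m).
Proof.
move=> n0 m0 [x1 x2].
pose code (y : G) := if y.2 == x2 :> nat then minn (x1 < y.1) n.-1
  else minn 2 n + minn (x2 < y.2) m.-1.
have hx1 := ltn_ord x1; have hx2 := ltn_ord x2.
apply: (card_le_inj (f := code)) => [[y1 y2]|[y1 y2] [z1 z2]] /=.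
  by move=> _; rewrite /code /=; case: ifP; lia.
have hy1 := ltn_ord y1; have hy2 := ltn_ord y2.
have hz1 := ltn_ord z1; have hz2 := ltn_ord z2.
rewrite /grid_adj /grid_dist /code /= => /eqP xy /eqP xz.
have line_distxx a : line_dist a a = 0 by rewrite /line_dist subnn.
have line_dist_gt0 a b : a <> b -> 0 < line_dist b a by rewrite /line_dist; lia.
have [Ey|/eqP/line_dist_gt0 Ny] := eqVneq (y2 : nat) x2;
  have [Ez|/eqP/line_dist_gt0 Nz] := eqVneq (z2 : nat) x2 => E; try lia.
  rewrite Ey line_distxx addn0 in xy; rewrite Ez line_distxx addn0 in xz.
  by apply: pair_ord_inj; rewrite /= ?Ey //; apply: (line_code (k := n)) xy xz E.
have Ey : x1 = y1 :> nat by apply: line_dist0; lia.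
have Ez : x1 = z1 :> nat by apply: line_dist0; lia.
rewrite -Ey line_distxx in xy; rewrite -Ez line_distxx in xz.
apply: pair_ord_inj => /=; first by rewrite -Ey.
by apply: (line_code (k := m)) xy xz _ => //; lia.
Qed.

End GridClasses.

Lemma mdeg_K n m : 0 < n -> 0 < m -> is_mdeg (K n m) (minn 2 n + minn 2 m).
Proof.
move=> n0 m0; split=> [|M k M_median M_cross [deg _]]; last first.
  exact: degree_lower_bound M_median M_cross deg.
exists (grid n m); split; [exact: grid_median | exact: Cross_grid | split].
  exact: grid_degree_le.
by move=> l; apply: degree_lower_bound (grid_median n m) (Cross_grid n m).
Qed.

Theorem corollary5p8 (n m : nat) (hn : 1 <= n) (hnm : n <= m) :
  [/\ m = 1 /\ n = 1 -> is_mdeg (K n m) 2,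
      2 <= m /\ n = 1 -> is_mdeg (K n m) 3 &
      2 <= m /\ 2 <= n -> is_mdeg (K n m) 4].
Proof.
have mdeg := mdeg_K hn (leq_trans hn hnm).
by split=> -[hm hn']; move: mdeg; congr is_mdeg; lia.
Qed.
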